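(* The algorithm k-CoreD described below is $\varepsilon$-local edge differentially private ($\varepsilon$-LEDP) for every $\varepsilon\in(0,1]$, every split fraction $f\in(0,1)$, every bias parameter $b\ge 0$ and all constants $\psi,\eta>0$.
   Context: Setting: $G=(V,E)$ is an undirected simple graph with $V=[n]$; $d_v$ is the degree of $v$. Each node knows only its own adjacency list. $\mathsf{Geom}(\beta)$ denotes the symmetric geometric distribution on $\mathbb{Z}$ with $\Pr[X=i]=\frac{e^\beta-1}{e^\beta+1}e^{-|i|\beta}$. Local randomizers and LEDP: an $\varepsilon$-local randomizer for node $v$ is a randomized algorithm taking as input $v$'s adjacency list (and previously released public information) such that for any two adjacency lists differing in exactly one element and any set $Y$ of outputs, the probabilities of landing in $Y$ differ by a factor in $[e^{-\varepsilon},e^{\varepsilon}]$. An algorithm in which each node only releases outputs of local randomizers (run on its own adjacency list and the public information released in previous rounds) is $\varepsilon$-LEDP if for every pair of nodes $u,v$, the sum of the privacy parameters of all local randomizers invoked by $u$ and by $v$ over the whole execution is at most $\varepsilon$. Algorithm k-CoreD (inputs $n$, $\varepsilon\in(0,1]$, $f\in(0,1)$, $b\ge 0$, constants $\psi,\eta>0$): set $L=\lceil\log_{1+\psi} n\rceil/4$, $\varepsilon_1=f\varepsilon$, $\varepsilon_2=(1-f)\varepsilon$, $\lambda=\frac{(5-2\eta)\eta}{(\eta+5)^2}$. (i) Degree thresholding: each node $v$ samples $X\sim\mathsf{Geom}(\varepsilon_1/2)$, sets $\widetilde d_v=d_v+X$, replaces $\widetilde d_v$ by $\widetilde d_v+1-\min(b\cdot\frac{2e^{\varepsilon_1}}{e^{2\varepsilon_1}-1},\widetilde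 d_v)$, and publicly releases $t_v=\lceil\log_2\widetilde d_v\rceil\cdot L$. (ii) Level moving: all nodes start at level $0$ and are active. Let $R=\min(4\log_{1+\psi}(n)\log(\widetilde d_{\max})-1,\max_v t_v)$ with $\widetilde d_{\max}=\max_v\widetilde d_v$. For $r=0,1,\dots,R$: every node $v$ with $t_v=r$ becomes permanently inactive; every active node $v$ at level $r$ computes $U_v$, the number of its neighbors at level $r$, samples $X\sim\mathsf{Geom}(s)$ with $s=\varepsilon_2/(2t_v)$, sets $B=\frac{6e^s}{(e^{2s}-1)^3}$, and if $U_v+X+B>(1+\eta/5)^{\lfloor r/L\rfloor}$ it moves up to level $r+1$, otherwise it becomes permanently inactive; all levels are published at the end of each round. (iii) Output: with $\ell(v)$ the final level of $v$, the core estimate $\hat k(v)=(2+\lambda)(1+\eta/5)^{\max(\lfloor(\ell(v)+1)/L\rfloor-1,0)}$, and the total order $D$ of nodes sorted by increasing level, ties broken by node ID.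
   Formalization: Since L is a multiple of 1/4, t_v may be fractional; with the test ''t_v = r'' such a node never times out and the privacy claim fails (n=2, ψ=1, b=0). The proved version tests ⌊t_v⌋ = r, the same whenever t_v is an integer; the noisy degrees are also released. *)

(* Defs.v *)
From HB Require Import structures.
From mathcomp Require Import all_boot all_order all_algebra.
From mathcomp Require Import ring.
From mathcomp Require Import all_classical all_reals all_analysis.

Set Implicit Arguments.
Unset Strict Implicit.
Unset Printing Implicit Defensive.

Import Order.TTheory GRing.Theory Num.Theory.
Import numFieldNormedType.Exports.

Local Open Scope classical_set_scope.
Local Open Scope ring_scope.

Definition logb {R : realType} (base x : R) : R := ln x / ln base.

HB.instance Definition _ := isPointed.Build int 0.

HB.instance Definition _ := @isMeasurable.Build default_measure_display
  int discrete_measurable discrete_measurable0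
  discrete_measurableC discrete_measurableU.

Definition geom_pmf {R : realType} (beta : R) (i : int) : R :=
  (expR beta - 1) / (expR beta + 1) * expR (- (`|i|%:~R * beta)).

(* Geom(beta).  The parameter is only meaningful for 0 < beta; as for the
   distributions of the library, other values are given a junk probability. *)
Definition geom_prob {R : realType} (beta : R) : set int -> \bar R :=
  fun U => if 0 < beta then (\esum_(i in U) (geom_pmf beta i)%:E)%E
           else \d_(0 : int) U.

Section geom_prob_is_probability.
Context {R : realType} (beta : R).
Local Open Scope ereal_scope.

Lemma geom_pmf_ge0 i : (0 < beta)%R -> (0 <= geom_pmf beta i)%R.
Proof.
move=> b0; apply: mulr_ge0; last exact: expR_ge0.
apply: divr_ge0; last by rewrite addr_ge0 ?expR_ge0.
by rewrite subr_ge0 -expR0 ler_expR ltW.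
Qed.

Let geom0 : geom_prob beta set0 = 0.
Proof. by rewrite /geom_prob measure0; case: ifPn => //; rewrite esum_set0. Qed.

Let geom_ge0 U : 0 <= geom_prob beta U.
Proof.
rewrite /geom_prob; case: ifPn => // b0; apply: esum_ge0 => /= i _.
by rewrite lee_fin geom_pmf_ge0.
Qed.

Let geom_sigma_additive : semi_sigma_additive (geom_prob beta).
Proof.
move=> F mF tF mUF; rewrite /geom_prob; case: ifPn => b0; last first.
  exact: measure_semi_sigma_additive.
apply: cvg_toP.
  apply: ereal_nondecreasing_is_cvgn => a b ab.
  apply: lee_sum_nneg_natr => // n _ _.
  by apply: esum_ge0 => /= ? _; rewrite lee_fin geom_pmf_ge0.
by rewrite nneseries_sum_bigcup// => i; rewrite lee_fin geom_pmf_ge0.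
Qed.

HB.instance Definition _ := isMeasure.Build _ _ _ (geom_prob beta)
  geom0 geom_ge0 geom_sigma_additive.

Let geom_half (h : nat -> int) (k : nat) : (0 < beta)%R ->
  (forall n, `|h n|%N = (n + k)%N) -> injective h ->
  \esum_(i in range h) (geom_pmf beta i)%:E =
  ((expR beta - 1) / (expR beta + 1) * expR (- beta) ^+ k
    / (1 - expR (- beta)))%:E.
Proof.
move=> b0 hE hI; have q1 : (`|expR (- beta)| < 1)%R.
  by rewrite ger0_norm ?expR_ge0// -expR0 ltr_expR oppr_lt0.
rewrite esum_image; last by move=> x y _ _ /hI.
rewrite -nneseries_esumT; last by move=> n; rewrite lee_fin geom_pmf_ge0.
have pE n : geom_pmf beta (h n) =
    geometric ((expR beta - 1) / (expR beta + 1) * expR (- beta) ^+ k)%R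
              (expR (- beta)) n.
  rewrite /geom_pmf /geometric/= -[RHS]mulrA; congr *%R.
  by rewrite -exprD -expRM_natl -abszE hE addnC mulrN.
under eq_eseriesr do rewrite pE.
apply: cvg_lim => //; apply/cvg_EFin.
  by apply: nearW => n; rewrite sumEFin.
have := @cvg_geometric_series R
  ((expR beta - 1) / (expR beta + 1) * expR (- beta) ^+ k)%R _ q1.
by apply: cvg_trans; apply: near_eq_cvg; apply: nearW => n; rewrite /= sumEFin.
Qed.

Let geom_setT : geom_prob beta [set: int] = 1.
Proof.
rewrite /geom_prob; case: ifPn => [b0|_]; last by rewrite probability_setT.
rewrite (esumID (range Posz)); last by move=> i _; rewrite lee_fin geom_pmf_ge0.
rewrite !setTI (_ : ~` range Posz = range Negz); last first.
  apply/seteqP; split => [[n|n] /= H|_ [n _ <-] [m _]//]; last by exists n.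
  by exfalso; apply: H; exists n.
rewrite (geom_half (k := 0) b0)//; last 2 first.
- by move=> n; rewrite absz_nat addn0.
- by move=> x y [].
rewrite (geom_half (k := 1) b0)//; last 2 first.
- by move=> n; rewrite addn1.
- by move=> x y [].
rewrite -EFinD; congr EFin.
have e1 : (1 < expR beta)%R by rewrite -expR0 ltr_expR.
rewrite expr0 expr1 expRN.
have e0 : (0 < expR beta)%R by exact: expR_gt0.
have d0 : (expR beta + 1 != 0)%R by rewrite gt_eqF// addr_gt0.
have d1 : (expR beta - 1 != 0)%R by rewrite gt_eqF// subr_gt0.
have n0 : (expR beta != 0)%R by rewrite gt_eqF.
by field; rewrite ?n0 ?d0 ?d1.
Qed.

HB.instance Definition _ :=
  @Measure_isProbability.Build _ _ R (geom_prob beta) geom_setT.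

End geom_prob_is_probability.

Record sgraph (n : nat) := SGraph {
  edge : rel 'I_n;
  edge_sym : symmetric edge;
  edge_irr : irreflexive edge }.

Definition adjacency n (G : sgraph n) (v : 'I_n) : {set 'I_n} :=
  [set u | edge G v u]%SET.

(* A randomized algorithm whose input is an adjacency list: it draws its noise
   from a probability space and returns a function of the list and the noise. *)
Record randomizer (R : realType) (n : nat) (M : Type) := Randomizer {
  noise_display : measure_display;
  noise_space : measurableType noise_display;
  noise : probability noise_space R;
  release : {set 'I_n} -> noise_space -> M }.

Arguments noise {R n M} _.
Arguments release {R n M} _ _ _.

Definition release_pr (R : realType) n M (rho : randomizer R n M) (a : {set 'I_n})
    (Y : set M) : \bar R :=
  noise rho (release rho a @^-1` Y).

(* The measurability premise is void when, as for integer noise, every subset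
   of the noise space is measurable. *)
Definition local_randomizer (R : realType) n M (v : 'I_n) (eps : R)
    (rho : randomizer R n M) : Prop :=
  forall a a' : {set 'I_n}, v \notin a -> v \notin a' ->
    #|((a :\: a') :|: (a' :\: a))%SET| = 1%N ->
  forall Y : set M, measurable (release rho a @^-1` Y) ->
    measurable (release rho a' @^-1` Y) ->
  ((expR (- eps))%:E * release_pr rho a' Y <= release_pr rho a Y)%E /\
  (release_pr rho a Y <= (expR eps)%:E * release_pr rho a' Y)%E.

(* Interactive algorithms in the local model.  In a round, every node v for
   which rho v is Some randomizer runs it (with fresh noise) on its own adjacency
   list and publishes the result; nodes with rho v = None stay silent.  All the
   rest of the algorithm is a function of the published values. *)
Inductive protocol (R : realType) (n : nat) (O : Type) : Type :=
  | Output of O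
  | Round (M : Type) (rho : 'I_n -> option (randomizer R n M))
          (next : ('I_n -> option M) -> protocol R n O).

Arguments Output {R n O}.
Arguments Round {R n O M}.

Definition published (R : realType) n M (G : sgraph n)
    (rho : 'I_n -> option (randomizer R n M)) (m : 'I_n -> option M) : Prop :=
  forall v, if rho v is Some r
            then exists w, m v = Some (release r (adjacency G v) w)
            else m v = None.

(* In every execution of p on G, randomizers can be assigned privacy parameters
   such that, added to what was spent before, the randomizers invoked by any two
   nodes u and v cost at most eps. *)
Fixpoint within_budget (R : realType) n O (G : sgraph n) (eps : R) (spent : 'I_n -> R)
    (p : protocol R n O) : Prop :=
  match p with
  | Output _ => forall u v, u != v -> spent u + spent v <= eps
  | Round M rho next =>
      exists e : 'I_n -> R,
        (forall v, if rho v is Some r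
                   then 0 <= e v /\ local_randomizer v (e v) r
                   else e v = 0) /\
        forall m : 'I_n -> option M, published G rho m ->
          within_budget G eps (fun v => spent v + e v) (next m)
  end.

Definition LEDP (R : realType) n O (eps : R) (p : protocol R n O) : Prop :=
  forall G : sgraph n, within_budget G eps (fun=> 0) p.

Section kCoreD.
Context {R : realType} (n : nat) (psi eta eps f b : R).

Definition L : R := (Num.ceil (logb (1 + psi) n%:R))%:~R / 4.
Definition eps1 : R := f * eps.
Definition eps2 : R := (1 - f) * eps.
Definition lambda : R := (5 - 2 * eta) * eta / (eta + 5) ^+ 2.

Definition noisy_degree (a : {set 'I_n}) (X : int) : R :=
  let d := #|a|%:R + X%:~R in
  d + 1 - Num.min (b * (2 * expR eps1 / (expR (2 * eps1) - 1))) d.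

Definition round_threshold (d : R) : R := (Num.ceil (logb 2 d))%:~R * L.

(* The noisy degree is published together with the threshold: the number of
   rounds is computed from the maximum of the noisy degrees. *)
Definition degree_randomizer : randomizer R n (R * R) :=
  Randomizer (geom_prob (eps1 / 2))
    (fun a X => let d := noisy_degree a X in (d, round_threshold d)).

(* The number of integers r with 0 <= r <= Rmax.  The unspecified base of the
   logarithm of dmax is 2, as in round_threshold. *)
Definition num_rounds (d t : 'I_n -> R) : nat :=
  let dmax := \big[Num.max/0]_v d v in
  let tmax := \big[Num.max/0]_v t v in
  let Rmax := Num.min (4 * logb (1 + psi) n%:R * logb 2 dmax - 1) tmax in
  if 0 <= Rmax then (Num.truncn Rmax).+1 else 0%N.

(* Rounds are integers, but t is only a multiple of 1/4 (as L is), so the test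
   t = r is read as floor t = r; see timed_out_int for integral t.  With the bare
   equality, a node with a fractional t would never time out and could invoke
   more than t randomizers of parameter eps2 / (2 * t). *)
Definition timed_out (t : R) (r : nat) : bool := Num.floor t == r%:Z.

Definition level_randomizer (level : 'I_n -> nat) (r : nat) (t : R) :
    randomizer R n nat :=
  let s := eps2 / (2 * t) in
  let B := 6 * expR s / (expR (2 * s) - 1) ^+ 3 in
  Randomizer (geom_prob s)
    (fun a X =>
       let U := #|[set u in a | level u == r]%SET| in
       if (1 + eta / 5) ^ Num.floor (r%:R / L) < U%:R + X%:~R + B
       then r.+1 else r).

Definition core_estimate (level : 'I_n -> nat) (v : 'I_n) : R :=
  (2 + lambda) *
  (1 + eta / 5) ^ Num.max (Num.floor ((level v).+1%:R / L) - 1) 0.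

Definition node_order (level : 'I_n -> nat) : seq 'I_n :=
  sort (fun u v => (level u < level v)%N ||
                   ((level u == level v) && (u <= v)%N)) (enum 'I_n).

Fixpoint level_moving (t : 'I_n -> R) (rounds : seq nat)
    (level : 'I_n -> nat) (active : {set 'I_n}) :
    protocol R n (('I_n -> R) * seq 'I_n) :=
  match rounds with
  | [::] => Output (core_estimate level, node_order level)
  | r :: rounds' =>
      let active' := [set v in active | ~~ timed_out (t v) r]%SET in
      Round (fun v => if (v \in active') && (level v == r)
                      then Some (level_randomizer level r (t v)) else None)
        (fun m => level_moving t rounds' (fun v => odflt (level v) (m v))
                    [set v in active' | m v != Some r]%SET)
  end.

Definition kCoreD : protocol R n (('I_n -> R) * seq 'I_n) :=
  Round (fun=> Some degree_randomizer)
    (fun m => let d v := (odflt (0, 0) (m v)).1 in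
              let t v := (odflt (0, 0) (m v)).2 in
              level_moving t (iota 0 (num_rounds d t)) (fun=> 0%N) [set: 'I_n]%SET).

End kCoreD.

Lemma timed_out_int (R : realType) (t : R) (r : nat) :
  t \is a Num.int -> timed_out t r = (t == r%:R).
Proof.
by move=> /intrP[z ->]; rewrite /timed_out intrKfloor -(eqr_int R).
Qed.

(* Main.v *)
(** Every message of a node is a function of [c + X], where the integer [c]
    counts some of its neighbors, hence changes by at most 1 with the adjacency
    list, and [X] has law Geom(beta); since the density of Geom(beta) changes by
    a factor at most [exp beta] under a unit shift, such a message costs [beta].
    A node thus spends [eps1 / 2] on its degree.  The bias never brings the noisy
    degree below 1, so [t] is nonnegative; a node then times out at round
    [floor t] and is asked to move at most [floor t] times, each time at cost
    [eps2 / (2 t)].  Its total is at most [(eps1 + eps2) / 2 = eps / 2]. *)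

Require Import Defs.
From mathcomp Require Import all_boot all_order all_algebra.
From mathcomp Require Import zify ring lra.
From mathcomp Require Import all_classical all_reals all_analysis.

Import Order.TTheory GRing.Theory Num.Theory.
Local Open Scope ring_scope.

Lemma ge0_esumZl {R : realType} {T : choiceType} (S : set T) (r : R)
    (a : T -> \bar R) : 0 <= r -> (forall i, (0 <= a i)%E) ->
  (\esum_(i in S) (r%:E * a i) = r%:E * \esum_(i in S) a i)%E.
Proof.
move=> r0 a0; rewrite /esum -ereal_supZl//; last first.
  apply/set0P; exists (\sum_(x \in set0) a x)%E.
  by exists set0 => //; exact: fsets_set0.
rewrite image_comp; congr ereal_sup.
by apply: eq_imagel => A _ /=; rewrite ge0_mule_fsumr.
Qed.

(** The normalizing factors agree, and [|i| <= |i + k| + 1] costs one factor [expR beta]. *)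
Lemma geom_pmf_shift {R : realType} (beta : R) (k i : int) :
  0 < beta -> `|k| <= 1 -> geom_pmf beta (i + k) <= expR beta * geom_pmf beta i.
Proof.
move=> b0 k1; rewrite /geom_pmf mulrCA; apply: ler_wpM2l.
  apply: divr_ge0; last by rewrite addr_ge0 ?expR_ge0.
  by rewrite subr_ge0 -expR0 ler_expR ltW.
have ik : `|i|%:~R <= `|i + k|%:~R + 1 :> R.
  rewrite -[1]/(1%:~R) -intrD ler_int.
  by have := ler_normB (i + k) k; rewrite addrK; lra.
by rewrite -expRD ler_expR; nra.
Qed.

(** Translation by [c' - c] carries the event of [c'] onto that of [c]; the densities are then
    compared term by term. *)
Lemma geom_prob_shift {R : realType} (beta : R) (c c' : int) (P : set int) :
  0 < beta -> `|c' - c| <= 1 ->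
  (geom_prob beta [set i | P (c + i)%R] <=
   (expR beta)%:E * geom_prob beta [set i | P (c' + i)%R])%E.
Proof.
move=> b0 cc'; rewrite /geom_prob b0.
rewrite (@reindex_esum _ _ _ [set i | P (c' + i)%R] _ (fun i => i + (c' - c))).
  rewrite -ge0_esumZl ?expR_ge0//; last by move=> i; rewrite lee_fin geom_pmf_ge0.
  by apply: le_esum => i _; rewrite -EFinM lee_fin geom_pmf_shift.
split=> [i /= Pi|i j _ _ /addIr//|i /= Pi].
- by rewrite (_ : c + _ = c' + i)//; lia.
- exists (i - (c' - c)); last exact: subrK.
  by rewrite /= (_ : c' + _ = c + i)//; lia.
Qed.

(** Used in both directions to show that the count of neighbors in [S] has sensitivity 1. *)
Lemma leq_card_symdiff {T : finType} (a a' S : {set T}) :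
  (#|a :&: S| <= #|a' :&: S| + #|(a :\: a') :|: (a' :\: a)|)%N.
Proof.
apply: (leq_trans _ (leq_card_setU _ _)); apply/subset_leq_card/fintype.subsetP => x.
by rewrite !inE; case: (x \in a) (x \in a') (x \in S) => [] [] [].
Qed.

(** [S] will be the full set for degrees and a level set for moves; the post-processing [h] is
    absorbed into the event as a preimage. *)
Lemma geom_local_randomizer {R : realType} {n : nat} {M : Type} (v : 'I_n)
    (beta : R) (S : {set 'I_n}) (h : int -> M) (g : {set 'I_n} -> int -> M) :
  0 < beta -> (forall a X, g a X = h (#|a :&: S|%:Z + X)) ->
  local_randomizer v beta (Randomizer (geom_prob beta) g).
Proof.
move=> b0 gE a a' _ _ aa' Y _ _.
have sens : `|#|a' :&: S|%:Z - #|a :&: S|%:Z| <= 1.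
  have := leq_card_symdiff a a' S; have := leq_card_symdiff a' a S.
  by rewrite finset.setUC aa'; lia.
rewrite /release_pr /=.
have preE d : (g d @^-1` Y)%classic =
    [set i | (h @^-1` Y)%classic (#|d :&: S|%:Z + i)]%classic.
  by apply/seteqP; split => i /=; rewrite gE.
rewrite !preE; split; last exact: geom_prob_shift.
(* The lower bound is the shift inequality with [a] and [a'] exchanged, divided by [expR beta]. *)
have := @geom_prob_shift R beta #|a' :&: S|%:Z #|a :&: S|%:Z (h @^-1` Y)%classic b0.
rewrite distrC => /(_ sens) H.
rewrite expRN -[leRHS]mul1e -(@mulVf _ (expR beta)) ?gt_eqF ?expR_gt0//.
by rewrite EFinM -muleA lee_pmul2l// lte_fin invr_gt0 expR_gt0.
Qed.

(** The subtracted minimum is at most [#|a| + X], whatever the sign of that sum. *)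
Lemma noisy_degree_ge1 {R : realType} {n : nat} (eps f b : R) (a : {set 'I_n})
    (X : int) : 0 < eps -> 0 < f -> 0 <= b -> 1 <= noisy_degree eps f b a X.
Proof.
move=> eps0 f0 b0; rewrite /noisy_degree; set d := _%:R + _; set c := b * _.
have c0 : 0 <= c.
  apply: mulr_ge0 => //; apply: divr_ge0; first by rewrite mulr_ge0 ?expR_ge0.
  by rewrite subr_ge0 -expR0 ler_expR mulr_ge0// mulr_ge0// ltW.
have : Num.min c d <= d by rewrite ge_min lexx orbT.
lra.
Qed.

Lemma ceil_ge0 {R : archiRealDomainType} (x : R) : 0 <= x -> 0 <= Num.ceil x.
Proof. by move=> x0; rewrite -(ler0z R) (le_trans x0)// ceil_ge. Qed.

Lemma logb_ge0 {R : realType} (base x : R) : 1 <= base -> 1 <= x -> 0 <= logb base x.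
Proof. by move=> base1 x1; rewrite divr_ge0 ?ln_ge0. Qed.

Lemma round_threshold_ge0 {R : realType} (n : nat) (psi d : R) :
  (0 < n)%N -> 0 < psi -> 1 <= d -> 0 <= round_threshold n psi d.
Proof.
move=> n0 psi0 d1; apply: mulr_ge0; first by rewrite ler0z ceil_ge0// logb_ge0// ler1n.
apply: divr_ge0 => //; rewrite ler0z ceil_ge0// logb_ge0 ?ler1n//.
by rewrite lerDl ltW.
Qed.

(** Both published values are functions of one noisy integer, so the pair is paid for only once. *)
Lemma degree_randomizer_local {R : realType} (n : nat) (psi eps f b : R) (v : 'I_n) :
  0 < eps1 eps f -> local_randomizer v (eps1 eps f / 2) (degree_randomizer n psi eps f b).
Proof.
move=> e0; pose d (k : int) := k%:~R + 1 -
  Num.min (b * (2 * expR (eps1 eps f) / (expR (2 * eps1 eps f) - 1))) k%:~R.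
apply: (@geom_local_randomizer _ _ _ _ _ [set: 'I_n]%SET
  (fun k => (d k, round_threshold n psi (d k)))); first by rewrite divr_gt0.
by move=> a X; rewrite /noisy_degree /d finset.setIT intrD.
Qed.

(** The levels are public, hence fixed while the adjacency list varies. *)
Lemma level_randomizer_local {R : realType} {n : nat} (psi eta eps f : R)
    (level : 'I_n -> nat) (r : nat) (t : R) (v : 'I_n) :
  0 < eps2 eps f -> 0 < t ->
  local_randomizer v (eps2 eps f / (2 * t)) (level_randomizer psi eta eps f level r t).
Proof.
move=> e0 t0; set s := eps2 eps f / (2 * t).
apply: (@geom_local_randomizer _ _ _ _ _ [set u | level u == r]%SET
  (fun k => if (1 + eta / 5) ^ Num.floor (r%:R / L n psi) <
    k%:~R + 6 * expR s / (expR (2 * s) - 1) ^+ 3 then r.+1 else r)).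
  by rewrite divr_gt0// mulr_gt0.
move=> a X; rewrite intrD -/s.
by rewrite (_ : [set u in a | _]%SET = a :&: [set u | level u == r]%SET)//;
  apply/setP => u; rewrite !inE.
Qed.

(* An active node [v] at round [r] has at most [floor (t v) - r <= t v - r]
   invocations left, whose cost is reserved in the budget. *)
Lemma level_moving_within_budget {R : realType} {n : nat} (psi eta eps f : R)
    (G : sgraph n) (t : 'I_n -> R) (k r : nat) (level : 'I_n -> nat)
    (active : {set 'I_n}) (spent : 'I_n -> R) :
  0 < eps2 eps f -> (forall v, 0 <= t v) ->
  (forall v, spent v <= eps / 2) ->
  (forall v, v \in active -> r%:Z <= Num.floor (t v) /\
    spent v + (t v - r%:R) * (eps2 eps f / (2 * t v)) <= eps / 2) ->
  within_budget G eps spent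
    (level_moving psi eta eps f t (iota r k) level active).
Proof.
move=> e0 t0; elim: k r level active spent => [|k IH] r level active spent sle act /=.
  by move=> u v _; have := sle u; have := sle v; lra.
set active' := [set v in active | _]%SET.
pose c v := eps2 eps f / (2 * t v).
have c0 v : 0 <= c v by apply: divr_ge0; [exact: ltW|exact: mulr_ge0].
(* Not being timed out excludes [floor (t v) = r], which turns [r <= floor (t v)] into a strict
   inequality. *)
have act' v : v \in active' -> [/\ (r.+1)%:Z <= Num.floor (t v),
    (r.+1)%:R <= t v & spent v + (t v - r%:R) * c v <= eps / 2].
  rewrite inE => /andP[/act[rt sv] to].
  have rt1 : (r.+1)%:Z <= Num.floor (t v) by move: to rt; rewrite /timed_out; lia.
  by split => //; rewrite floor_ge_int in rt1.
exists (fun v => if (v \in active') && (level v == r) then c v else 0); split.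
  move=> v; case: ifPn => // /andP[/act'[_ tr _] _]; split; first exact: c0.
  by apply: level_randomizer_local => //; apply: lt_le_trans tr; rewrite ltr0n.
move=> m _; apply: IH => v.
  case: ifPn => [/andP[/act'[_ tr sv] _]|_]; last by rewrite addr0.
  (* Since [t v - r >= 1], the reserve covers one more cost [c v]. *)
  by have := c0 v; move: tr; rewrite -natr1 => tr cv; nra.
rewrite inE => /andP[/act'[rt _ sv] _]; split => //.
have := c0 v; rewrite -/(c v) -natr1.
(* An invocation moves one [c v] from the reserve to the expense; a silent node just gives it up. *)
by case: ifP => _ cv; nra.
Qed.

Theorem theorem3p3 (R : realType) (n : nat) (psi eta eps f b : R)
    (psi_gt0 : 0 < psi) (eta_gt0 : 0 < eta)
    (eps_gt0 : 0 < eps) (eps_le1 : eps <= 1)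
    (f_gt0 : 0 < f) (f_lt1 : f < 1) (b_ge0 : 0 <= b) :
  LEDP eps (kCoreD n psi eta eps f b).
Proof.
move=> G /=.
have e1 : 0 < eps1 eps f by exact: mulr_gt0.
have e2 : 0 < eps2 eps f by rewrite mulr_gt0// subr_gt0.
have e12 : eps1 eps f + eps2 eps f = eps by rewrite /eps1 /eps2; lra.
exists (fun=> eps1 eps f / 2); split.
  by move=> v; split; [rewrite divr_ge0// ltW|exact: degree_randomizer_local].
move=> m pub; set t := fun v => (odflt (0, 0) (m v)).2.
have t0 v : 0 <= t v.
  rewrite /t; have [X ->] := pub v; apply: round_threshold_ge0 => //.
    exact: leq_ltn_trans (ltn_ord v).
  exact: noisy_degree_ge1.
apply: level_moving_within_budget => // v; first by lra.
rewrite floor_ge0 t0 subr0; split => //.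
(* The reserve [t v * (eps2 / (2 * t v))] is [eps2 / 2], except that it vanishes when [t v = 0]. *)
have [->|tv0] := eqVneq (t v) 0; first by rewrite mul0r; lra.
rewrite (_ : t v * _ = eps2 eps f / 2); first by lra.
by field.
Qed.
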